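(* Let $q\ge 1$, let $f$ be non-decreasing on the directed graph $G=(V,E)$, and let $V_0\subseteq V$. Let $r_{q,+},r_{q,-}:\{1,2,\ldots\}\to[0,\infty)$ be non-increasing functions satisfying, for all $m\ge 1$, $$r_{q,+}(m)\ \ge\ \max\Big\{\mathbb{E}\Big(\max_{u\preceq x}\sum_{x_i\in[u,v]}\frac{\varepsilon_i}{n_{u,v}}\Big)_+^q:\ n_{x,v}=m,\ x\preceq v,\ v\in V_0\Big\},$$ $$r_{q,-}(m)\ \ge\ \max\Big\{\mathbb{E}\Big(\min_{v\succeq x}\sum_{x_i\in[u,v]}\frac{\varepsilon_i}{n_{u,v}}\Big)_-^q:\ n_{u,x}=m,\ u\preceq x,\ u\in V_0\Big\}.$$ For $x\in V_0$ define $$m_{x}=\max\big\{n_{x,v}:\ f(v)\le f(x)+r_{q,+}^{1/q}(n_{x,v}),\ x\preceq v,\ v\in V_0\big\},$$ $$m_{x,-}=\max\big\{n_{u,x}:\ f(u)\ge f(x)-r_{q,-}^{1/q}(n_{u,x}),\ u\preceq x,\ u\in V_0\big\},$$ and for integers $m\ge 0$ let $\ell_+(m)=\#\{i:x_i\in V_0,\ m_{x_i}\le m\}$ and $\ell_-(m)=\#\{i:x_i\in V_0,\ m_{x_i,-}\le m\}$. Then for any block estimator $\widehat f_n^{(block)}$ and every design point $x_i\in V_0$, $$\mathbb{E}\big\{\widehat f_n^{(block)}(x_i)-f(x_i)\big\}_+^q\le 2^q r_{q,+}(m_{x_i}),\qquad \mathbb{E}\big\{\widehat f_n^{(block)}(x_i)-f(x_i)\big\}_-^q\le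 2^q r_{q,-}(m_{x_i,-}).$$ Consequently, for any upper bounds $\ell_\pm^*(m)\ge\ell_\pm(m)$ with $\ell_\pm^*(0)=0$, $$\sum_{x_i\in V_0}\mathbb{E}\big|\widehat f_n^{(block)}(x_i)-f(x_i)\big|^q\le\sum_{m=1}^\infty 2^q r_{q,+}(m)\{\ell_+^*(m)-\ell_+^*(m-1)\}+\sum_{m=1}^\infty 2^q r_{q,-}(m)\{\ell_-^*(m)-\ell_-^*(m-1)\}.$$
   Context: $G=(V,E)$ is a directed graph. For $a,b\in V$, write $a\preceq b$ (equivalently $b\succeq a$) if $a=b$ or there is a finite chain of directed edges from $b$ to $a$. A function $f:V\to\mathbb{R}$ is non-decreasing on $G$ if $f(a)\le f(b)$ whenever $a\preceq b$. We observe design points $x_1,\ldots,x_n\in V$ (deterministic) and $y_i=f(x_i)+\varepsilon_i$, $i=1,\ldots,n$, with independent noise variables, $\mathbb{E}\varepsilon_i=0$, $\mathrm{Var}(\varepsilon_i)\le\sigma^2$. For $u,v\in V$: $[u,v]=\{x\in V:u\preceq x\preceq v\}$, $n_{u,v}=\#\{i\le n:x_i\in[u,v]\}$, $n_{u,*}=\#\{i:u\preceq x_i\}$, $n_{*,v}=\#\{i:x_i\preceq v\}$; $\overline y_A$ is the average of the $y_i$ over $\{i:x_i\in A\}$. Sums $\sum_{x_i\in A}$ are over the indices $i$ with $x_i\in A$. $(t)_+=\max(t,0)$, $(t)_-=\max(-t,0)$. A maximum over an empty family of expectations is read as $0$. The max-min and min-max estimators are $$\widehat f_n^{(max-min)}(x)=\max_{u\preceq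 x,\,n_{u,*}>0}\ \min_{x\preceq v,\,n_{u,v}>0}\overline y_{[u,v]},\qquad \widehat f_n^{(min-max)}(x)=\min_{x\preceq v,\,n_{*,v}>0}\ \max_{u\preceq x,\,n_{u,v}>0}\overline y_{[u,v]}.$$ A block estimator is any estimator $\widehat f_n^{(block)}$ with $\min\{\widehat f_n^{(max-min)}(x),\widehat f_n^{(min-max)}(x)\}\le\widehat f_n^{(block)}(x)\le\max\{\widehat f_n^{(max-min)}(x),\widehat f_n^{(min-max)}(x)\}$ for all $x\in V$. *)

(* Defs.v *)
From mathcomp Require Import all_boot all_order all_algebra.
From mathcomp Require Import all_classical all_reals all_analysis.
From Stdlib Require Export Relation_Operators.

Set Implicit Arguments.
Unset Strict Implicit.
Unset Printing Implicit Defensive.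

Import Order.TTheory GRing.Theory Num.Theory.
Import numFieldNormedType.Exports.

Local Open Scope classical_set_scope.
Local Open Scope ring_scope.

(* [E b a] is a directed edge from [b] to [a]; the vertex set may be infinite. *)
Definition preceq (V : Type) (E : V -> V -> Prop) (a b : V) : Prop :=
  a = b \/ clos_trans V E b a.

Definition nondecreasing_on (V : Type) (E : V -> V -> Prop) (R : realType)
    (f : V -> R) : Prop :=
  forall a b : V, preceq E a b -> f a <= f b.

Definition block (V : Type) (E : V -> V -> Prop) (u v : V) : set V :=
  [set z | preceq E u z /\ preceq E z v].

Definition upset (V : Type) (E : V -> V -> Prop) (u : V) : set V :=
  [set z | preceq E u z].

Definition downset (V : Type) (E : V -> V -> Prop) (v : V) : set V :=
  [set z | preceq E z v].

Definition nobs (V : Type) (n : nat) (x : 'I_n -> V) (A : set V) : nat :=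
  #|[pred i : 'I_n | x i \in A]|.

Definition avg (V : Type) (R : realType) (n : nat) (x : 'I_n -> V)
    (y : 'I_n -> R) (A : set V) : R :=
  (\sum_(i < n | x i \in A) y i) / (nobs x A)%:R.

(* An average depends on its block only through the set of indices of the
   design points it contains. So every [sup] and [inf] of averages below is over
   a finite set of values, and is a maximum or a minimum when that set is
   nonempty. *)

Definition max_min (V : Type) (E : V -> V -> Prop) (R : realType) (n : nat)
    (x : 'I_n -> V) (y : 'I_n -> R) (z : V) : R :=
  sup [set inf [set avg x y (block E u v) | v in
                  [set v | preceq E z v /\ (0 < nobs x (block E u v))%N]]
      | u in [set u | preceq E u z /\ (0 < nobs x (upset E u))%N]].

Definition min_max (V : Type) (E : V -> V -> Prop) (R : realType) (n : nat)
    (x : 'I_n -> V) (y : 'I_n -> R) (z : V) : R :=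
  inf [set sup [set avg x y (block E u v) | u in
                  [set u | preceq E u z /\ (0 < nobs x (block E u v))%N]]
      | v in [set v | preceq E z v /\ (0 < nobs x (downset E v))%N]].

(* Away from the design points the families above may be empty. The two
   predicates below say that none of them is, so that the corresponding formula
   defines a number; both hold whenever [z] is a design point. *)

Definition max_min_defined (V : Type) (E : V -> V -> Prop) (n : nat)
    (x : 'I_n -> V) (z : V) : Prop :=
  (exists u, preceq E u z /\ (0 < nobs x (upset E u))%N) /\
  (forall u, preceq E u z -> (0 < nobs x (upset E u))%N ->
     exists v, preceq E z v /\ (0 < nobs x (block E u v))%N).

Definition min_max_defined (V : Type) (E : V -> V -> Prop) (n : nat)
    (x : 'I_n -> V) (z : V) : Prop :=
  (exists v, preceq E z v /\ (0 < nobs x (downset E v))%N) /\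
  (forall v, preceq E z v -> (0 < nobs x (downset E v))%N ->
     exists u, preceq E u z /\ (0 < nobs x (block E u v))%N).

(* [g] is the estimated function for the data [y]. It is unconstrained at the
   points where one of the two estimators is not defined. *)
Definition is_block_estimate (V : Type) (E : V -> V -> Prop) (R : realType)
    (n : nat) (x : 'I_n -> V) (y : 'I_n -> R) (g : V -> R) : Prop :=
  forall z : V, max_min_defined E x z -> min_max_defined E x z ->
    Num.min (max_min E x y z) (min_max E x y z) <= g z /\
    g z <= Num.max (max_min E x y z) (min_max E x y z).

Definition pos_part (R : realType) (t : R) : R := Num.max t 0.

Definition neg_part (R : realType) (t : R) : R := Num.max (- t) 0.

Definition mutually_independent (d : measure_display) (T : measurableType d)
    (R : realType) (P : probability T R) (n : nat)
    (X : 'I_n -> {RV P >-> R}) : Prop :=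
  forall (J : {set 'I_n}) (A : 'I_n -> set R),
    (forall i, measurable (A i)) ->
    P (\bigcap_(i in [set` J]) (X i @^-1` A i)) =
    (\prod_(i in J) fine (P (X i @^-1` A i)))%:E.

(* The maximum with [0] only matters for an empty family of expectations. *)

Definition max_noise_pos (d : measure_display) (T : measurableType d)
    (R : realType) (P : probability T R) (V : Type) (E : V -> V -> Prop)
    (n : nat) (x : 'I_n -> V) (eps : 'I_n -> {RV P >-> R}) (V0 : set V)
    (q : R) (m : nat) : \bar R :=
  maxe (0 : \bar R)%E (ereal_sup [set e | exists z v,
    [/\ nobs x (block E z v) = m, preceq E z v, V0 v &
      e = ('E_P[fun w => (pos_part (sup
            [set avg x (fun i => eps i w) (block E u v) | u in
              [set u | preceq E u z]]) `^ q)%R])%E]]).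

Definition max_noise_neg (d : measure_display) (T : measurableType d)
    (R : realType) (P : probability T R) (V : Type) (E : V -> V -> Prop)
    (n : nat) (x : 'I_n -> V) (eps : 'I_n -> {RV P >-> R}) (V0 : set V)
    (q : R) (m : nat) : \bar R :=
  maxe (0 : \bar R)%E (ereal_sup [set e | exists z u,
    [/\ nobs x (block E u z) = m, preceq E u z, V0 u &
      e = ('E_P[fun w => (neg_part (inf
            [set avg x (fun i => eps i w) (block E u v) | v in
              [set v | preceq E z v]]) `^ q)%R])%E]]).

(* Rates have domain {1, 2, ...}: their value at [0] is never used. In particular
   only blocks containing a design point compete in the next two maxima, which
   are positive at design points in [V0]. *)

Definition is_rate (R : realType) (r : nat -> R) : Prop :=
  (forall m, (0 < m)%N -> 0 <= r m) /\
  (forall m m', (0 < m)%N -> (m <= m')%N -> r m' <= r m).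

Definition m_pos (V : Type) (E : V -> V -> Prop) (R : realType) (n : nat)
    (x : 'I_n -> V) (f : V -> R) (V0 : set V) (q : R) (r : nat -> R)
    (z : V) : nat :=
  (\max_(k < n.+1 | `[< exists v,
      [/\ nobs x (block E z v) = k, (0 < k)%N,
          (f v <= f z + r k `^ q^-1)%R, preceq E z v & V0 v] >]) k)%N.

Definition m_neg (V : Type) (E : V -> V -> Prop) (R : realType) (n : nat)
    (x : 'I_n -> V) (f : V -> R) (V0 : set V) (q : R) (r : nat -> R)
    (z : V) : nat :=
  (\max_(k < n.+1 | `[< exists u,
      [/\ nobs x (block E u z) = k, (0 < k)%N,
          (f z - r k `^ q^-1 <= f u)%R, preceq E u z & V0 u] >]) k)%N.

Definition ell (V : Type) (n : nat) (x : 'I_n -> V) (V0 : set V)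
    (mx : V -> nat) (m : nat) : nat :=
  #|[pred i : 'I_n | (x i \in V0) && (mx (x i) <= m)%N]|.

(* Main.v *)
Require Import Defs.
From mathcomp Require Import all_boot all_order all_algebra.
From mathcomp Require Import all_classical all_reals all_analysis.
From mathcomp Require Import measurable_realfun lra ring.

Import Order.TTheory GRing.Theory Num.Theory.
Import numFieldNormedType.Exports.

Local Open Scope classical_set_scope.
Local Open Scope ring_scope.

(** Fix a design point [z = x_i] in [V0] and choose [v] in [V0], above [z], whose
    block [[z, v]] attains the maximum defining [m_pos z]. Both estimators at [z]
    are at most the largest average of the data over the blocks [[u, v]] with
    [u] below [z]: each of these contains [z], so it competes in the max-min
    formula when [v] is tried in the inner minimum, and in the min-max formula
    when [v] is tried in the outer one ([block_estimate_le]). By monotonicity the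
    average of [f] over [[u, v]] is at most [f v], which the choice of [v] keeps
    below [f z + r (m_pos z) `^ q^-1]. Hence, with [S] the largest average noise
    over the blocks [[u, v]] ([block_error_le]),

      [fhat z - f z <= r (m_pos z) `^ q^-1 + S].

    The rate bounds the [q]-th moment of the positive part of [S] by
    [r (m_pos z)], and the convexity inequality
    [(a + b) `^ q <= 2 `^ q / 2 * (a `^ q + b `^ q)] turns the sum of two terms of
    size [r `^ q^-1] into the constant [2 `^ q] ([expectation_pos_part_le],
    [pos_risk_le]).

    The bound on negative parts is the same statement for the reversed graph and
    the negated data: this duality exchanges the max-min and min-max estimators
    and turns [m_neg] into [m_pos] ([is_block_estimate_rev], [m_neg_rev]).

    For the total risk, [`|t| `^ q] is the sum of its positive and negative
    contributions, so it remains to compare the sum of [r (m_pos (x_i))] with a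
    series. The increments of the counting function [ell] group the design points
    by the value of [m_pos], and replacing [ell] by an upper bound [l] can only
    enlarge the series because [r] is non-increasing, by summation by parts
    ([sum_rate_le]). *)

(** * Reversal of the edges *)

Lemma preceq_refl {V : Type} (E : V -> V -> Prop) (a : V) : preceq E a a.
Proof. by left. Qed.

Definition rev_edge {V : Type} (E : V -> V -> Prop) : V -> V -> Prop :=
  fun a b => E b a.

Lemma preceq_rev {V : Type} (E : V -> V -> Prop) (a b : V) :
  preceq (rev_edge E) a b = preceq E b a.
Proof.
have rev E' c d : clos_trans V E' c d -> clos_trans V (rev_edge E') d c.
  elim=> [c' d' h|c' e d' _ h1 _ h2]; first exact: t_step.
  exact: t_trans h2 h1.
apply/propext; split=> -[->|h]; [exact: preceq_refl|right|exact: preceq_refl|right].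
  exact: rev h.
exact: rev h.
Qed.

Lemma block_rev {V : Type} (E : V -> V -> Prop) (u v : V) :
  block (rev_edge E) u v = block E v u.
Proof.
by apply/seteqP; split=> z; rewrite /block /= !(preceq_rev E) => -[].
Qed.

Lemma downset_rev {V : Type} (E : V -> V -> Prop) (v : V) :
  downset (rev_edge E) v = upset E v.
Proof. by apply/seteqP; split=> z; rewrite /downset /upset /= (preceq_rev E). Qed.

Lemma avgN {V : Type} {R : realType} {n : nat} (x : 'I_n -> V) (y : 'I_n -> R)
    (A : set V) :
  avg x (fun i => - y i) A = - avg x y A.
Proof. by rewrite /avg sumrN mulNr. Qed.

(** Reversal turns the data into their opposites, so the formulas of the two
    estimators are exchanged by these two rules. *)
Lemma inf_opp {R : realType} (I : Type) (D : set I) (h : I -> R) :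
  inf [set - h i | i in D] = - sup [set h i | i in D].
Proof.
rewrite /inf image_comp; congr (- sup _).
by apply: eq_imagel => i _ /=; rewrite opprK.
Qed.

Lemma sup_opp {R : realType} (I : Type) (D : set I) (h : I -> R) :
  sup [set - h i | i in D] = - inf [set h i | i in D].
Proof. by rewrite /inf image_comp opprK. Qed.

Lemma min_max_rev {V : Type} {R : realType} {n : nat} (E : V -> V -> Prop)
    (x : 'I_n -> V) (y : 'I_n -> R) (z : V) :
  min_max (rev_edge E) x (fun i => - y i) z = - max_min E x y z.
Proof.
rewrite /min_max /max_min -inf_opp; congr inf.
have -> : [set v | preceq (rev_edge E) z v /\
                   (0 < nobs x (downset (rev_edge E) v))%N] =
          [set u | preceq E u z /\ (0 < nobs x (upset E u))%N].
  by apply/seteqP; split=> v; rewrite /= (preceq_rev E) (downset_rev E).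
apply: eq_imagel => v _; rewrite -sup_opp; congr sup.
have -> : [set u | preceq (rev_edge E) u z /\
                   (0 < nobs x (block (rev_edge E) u v))%N] =
          [set u | preceq E z u /\ (0 < nobs x (block E v u))%N].
  by apply/seteqP; split=> u; rewrite /= (preceq_rev E) (block_rev E).
by apply: eq_imagel => u _; rewrite (block_rev E) avgN.
Qed.

Lemma max_min_rev {V : Type} {R : realType} {n : nat} (E : V -> V -> Prop)
    (x : 'I_n -> V) (y : 'I_n -> R) (z : V) :
  max_min (rev_edge E) x (fun i => - y i) z = - min_max E x y z.
Proof.
have := min_max_rev (rev_edge E) x (fun i => - y i) z.
rewrite -[rev_edge (rev_edge E)]/E => e; apply: oppr_inj; rewrite opprK -e.
by congr min_max; apply/funext => i; rewrite opprK.
Qed.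

(** The defining interval of a block estimate is symmetric in the two
    estimators, which reversal exchanges up to sign. *)
Lemma is_block_estimate_rev {V : Type} {R : realType} {n : nat}
    (E : V -> V -> Prop) (x : 'I_n -> V) (y : 'I_n -> R) (g : V -> R) :
  is_block_estimate E x y g ->
  is_block_estimate (rev_edge E) x (fun i => - y i) (fun z => - g z).
Proof.
have defd E' z : min_max_defined E' x z -> max_min_defined (rev_edge E') x z.
  move=> [[v [zv hv]] h]; split.
    exists v; rewrite (preceq_rev E'); split=> //.
    by move: hv; rewrite -(downset_rev (rev_edge E')).
  move=> u; rewrite (preceq_rev E') => zu hu.
  have [|w [wz hw]] := h u zu.
    by move: hu; rewrite -(downset_rev (rev_edge E')).
  by exists w; rewrite (preceq_rev E') (block_rev E').
have defd' E' z : max_min_defined E' x z -> min_max_defined (rev_edge E') x z.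
  move=> [[v [zv hv]] h]; split.
    by exists v; rewrite (preceq_rev E') (downset_rev E').
  move=> u; rewrite (preceq_rev E') (downset_rev E') => zu hu.
  have [w [wz hw]] := h u zu hu.
  by exists w; rewrite (preceq_rev E') (block_rev E').
move=> hg z /defd' d1 /defd d2.
have [lo up] := hg z d2 d1.
rewrite min_max_rev max_min_rev -oppr_max -oppr_min !lerN2.
by rewrite minC maxC.
Qed.

Lemma m_neg_rev {V : Type} {R : realType} {n : nat} (E : V -> V -> Prop)
    (x : 'I_n -> V) (f : V -> R) (V0 : set V) (q : R) (r : nat -> R) (z : V) :
  m_neg E x f V0 q r z = m_pos (rev_edge E) x (fun v => - f v) V0 q r z.
Proof.
apply: eq_bigl => k; congr asbool; apply/propext.
split=> -[u [h1 h2 h3 h4 h5]]; exists u.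
  by rewrite (preceq_rev E) (block_rev E); split=> //; lra.
by move: h1 h4; rewrite (preceq_rev E) (block_rev E); split=> //; lra.
Qed.

(** * Block averages *)

(** The bound does not depend on the set [A], so all suprema and infima of
    averages below are those of bounded sets, although [V] may be infinite. *)
Lemma avg_bounded {V : Type} {R : realType} {n : nat} (x : 'I_n -> V)
    (y : 'I_n -> R) (A : set V) :
  `|avg x y A| <= \sum_(i < n) `|y i|.
Proof.
rewrite /avg normrM normfV [`|_%:R|]ger0_norm //.
have sum_le : `|\sum_(i < n | x i \in A) y i| <= \sum_(i < n) `|y i|.
  apply: le_trans (ler_norm_sum _ _ _) _.
  rewrite [leRHS](bigID (fun i => x i \in A)) /= lerDl.
  by apply: sumr_ge0 => i _; exact: normr_ge0.
have [->|N_gt0] := posnP (nobs x A).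
  by rewrite invr0 mulr0 sumr_ge0.
rewrite ler_pdivrMr ?ltr0n //; apply: le_trans sum_le _.
by rewrite ler_peMr ?ler1n // sumr_ge0.
Qed.

Lemma has_ubound_avg {V : Type} {R : realType} {n : nat} (x : 'I_n -> V)
    (y : 'I_n -> R) (I : Type) (D : set I) (B : I -> set V) :
  has_ubound [set avg x y (B u) | u in D].
Proof.
exists (\sum_(i < n) `|y i|) => _ [u _ <-].
exact: le_trans (ler_norm _) (avg_bounded x y (B u)).
Qed.

Lemma has_lbound_avg {V : Type} {R : realType} {n : nat} (x : 'I_n -> V)
    (y : 'I_n -> R) (I : Type) (D : set I) (B : I -> set V) :
  has_lbound [set avg x y (B u) | u in D].
Proof.
exists (- \sum_(i < n) `|y i|) => _ [u _ <-].
by have := avg_bounded x y (B u); rewrite ler_norml => /andP[].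
Qed.

Lemma nobs_gt0 {V : Type} {n : nat} (x : 'I_n -> V) (A : set V) (i : 'I_n) :
  A (x i) -> (0 < nobs x A)%N.
Proof. by move=> Axi; apply/card_gt0P; exists i; apply: mem_set. Qed.

(** Among the blocks that contain [x i], fixing the upper end [v] bounds both
    estimators at once: in max-min [v] is one candidate for the inner minimum,
    in min-max it is one candidate for the outer minimum. *)
Lemma block_estimate_le {V : Type} {R : realType} {n : nat}
    (E : V -> V -> Prop) (x : 'I_n -> V) (y : 'I_n -> R) (g : V -> R)
    (i : 'I_n) (v : V) :
  is_block_estimate E x y g -> preceq E (x i) v ->
  g (x i) <= sup [set avg x y (block E u v) | u in [set u | preceq E u (x i)]].
Proof.
move=> g_block xv; set S := sup _.
have block_gt0 u w : preceq E u (x i) -> preceq E (x i) w ->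
    (0 < nobs x (block E u w))%N.
  by move=> ux xw; apply: (@nobs_gt0 _ _ _ _ i); split.
have upset_gt0 u : preceq E u (x i) -> (0 < nobs x (upset E u))%N.
  by move=> ux; apply: (@nobs_gt0 _ _ _ _ i).
have downset_gt0 w : preceq E (x i) w -> (0 < nobs x (downset E w))%N.
  by move=> xw; apply: (@nobs_gt0 _ _ _ _ i).
have xx := preceq_refl E (x i).
have max_min_ok : max_min_defined E x (x i).
  split; first by exists (x i); split=> //; exact: upset_gt0.
  by move=> u ux _; exists (x i); split=> //; exact: block_gt0.
have min_max_ok : min_max_defined E x (x i).
  split; first by exists (x i); split=> //; exact: downset_gt0.
  by move=> w xw _; exists (x i); split=> //; exact: block_gt0.
have avg_le_S u : preceq E u (x i) -> avg x y (block E u v) <= S.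
  by move=> ux; apply: ub_le_sup; [exact: has_ubound_avg|exists u].
have [_ /le_trans] := g_block _ max_min_ok min_max_ok; apply.
rewrite ge_max; apply/andP; split.
  apply: ge_sup.
    by eexists; exists (x i); [split=> //; exact: upset_gt0|reflexivity].
  move=> _ [u [ux _] <-]; apply: le_trans (avg_le_S u ux).
  apply: ge_inf; first exact: has_lbound_avg.
  by exists v; [split=> //; exact: block_gt0|].
apply: le_trans (_ : sup [set avg x y (block E u v) | u in
    [set u | preceq E u (x i) /\ (0 < nobs x (block E u v))%N]] <= S).
  apply: ge_inf.
    (* The inner suprema are bounded below because the block from [x i] to [w]
       always competes. *)
    exists (- \sum_(j < n) `|y j|) => _ [w [xw _] <-].
    apply: le_trans (_ : avg x y (block E (x i) w) <= _).
      by have := avg_bounded x y (block E (x i) w); rewrite ler_norml => /andP[].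
    apply: ub_le_sup; first exact: has_ubound_avg.
    by exists (x i); [split=> //; exact: block_gt0|].
  by exists v; [split=> //; exact: downset_gt0|].
apply: ge_sup.
  by eexists; exists (x i); [split=> //; exact: block_gt0|reflexivity].
by move=> _ [u [ux _] <-]; exact: avg_le_S.
Qed.

(** Monotonicity bounds every value of [f] in the block, hence its average, by
    the value at the upper end; only the averaged noise remains. *)
Lemma block_error_le {V : Type} {R : realType} {n : nat}
    (E : V -> V -> Prop) (x : 'I_n -> V) (f : V -> R) (e : 'I_n -> R)
    (g : V -> R) (i : 'I_n) (v : V) :
  nondecreasing_on E f ->
  is_block_estimate E x (fun j => f (x j) + e j) g -> preceq E (x i) v ->
  g (x i) - f v <=
    sup [set avg x e (block E u v) | u in [set u | preceq E u (x i)]].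
Proof.
move=> f_nd g_block xv; rewrite lerBlDl.
apply: le_trans (block_estimate_le _ _ _ _ _ _ g_block xv) _.
apply: ge_sup.
  by eexists; exists (x i); [exact: preceq_refl|reflexivity].
move=> _ [u ux <-].
apply: le_trans (_ : f v + avg x e (block E u v) <= _); last first.
  by rewrite lerD2l; apply: ub_le_sup; [exact: has_ubound_avg|exists u].
have N_gt0 : (0 < nobs x (block E u v))%N by apply: (@nobs_gt0 _ _ _ _ i).
rewrite /avg big_split mulrDl lerD2r ler_pdivrMr ?ltr0n //.
apply: le_trans (_ : \sum_(j < n | x j \in block E u v) f v <= _).
  by apply: ler_sum => j /set_mem[_ jv]; exact: f_nd.
by rewrite sumr_const mulr_natr.
Qed.

(** * Measurability of the largest average *)
Lemma measurable_bigmax {d : measure_display} {T : measurableType d}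
    {R : realType} {K : Type} (s : seq K) (Q : pred K) (h0 : T -> R)
    (h : K -> T -> R) :
  measurable_fun setT h0 -> (forall k, measurable_fun setT (h k)) ->
  measurable_fun setT (fun w => \big[Num.max/h0 w]_(k <- s | Q k) h k w).
Proof.
move=> mh0 mh; elim: s => [|k s IH].
  by under eq_fun do rewrite big_nil.
under eq_fun do rewrite big_cons.
by case: (Q k) => //; exact: measurable_maxr.
Qed.

(** The index set [D] may be uncountable, but an average depends on its block
    only through the set of indices of the design points inside it. So the
    supremum is a maximum over the finite type of sets of indices. *)
Lemma measurable_sup_avg {d : measure_display} {T : measurableType d}
    {R : realType} {V : Type} {n : nat} (x : 'I_n -> V) (e : 'I_n -> T -> R)
    (I : Type) (D : set I) (B : I -> set V) :
  (forall j, measurable_fun setT (e j)) -> D !=set0 ->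
  measurable_fun setT
    (fun w => sup [set avg x (fun j => e j w) (B u) | u in D]).
Proof.
move=> me [u0 Du0].
pose idx (A : set V) : {set 'I_n} := [set j | x j \in A]%SET.
pose h (J : {set 'I_n}) w : R := (\sum_(j in J) e j w) / #|J|%:R.
have hE A w : avg x (fun j => e j w) A = h (idx A) w.
  rewrite /avg /h /nobs; congr (_ / _).
    by apply: eq_bigl => j; rewrite inE.
  by congr (_%:R); apply: eq_card => j; rewrite !inE.
pose Q (J : {set 'I_n}) := `[< exists2 u, D u & idx (B u) = J >].
have mh J : measurable_fun setT (h J).
  apply: measurable_funM => //.
  by under eq_fun do rewrite -big_enum /=; exact: measurable_sum.
rewrite (_ : (fun w => _) =
    fun w => \big[Num.max/h (idx (B u0)) w]_(J | Q J) h J w).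
  exact: measurable_bigmax.
apply/funext => w; apply/le_anti/andP; split.
  apply: ge_sup; first by eexists; exists u0; [|reflexivity].
  move=> _ [u Du <-]; rewrite hE.
  by apply: le_bigmax_cond; apply/asboolP; exists u.
apply/bigmax_leP; split=> [|J /asboolP[u Du <-]]; rewrite -hE.
  by apply: ub_le_sup; [exact: has_ubound_avg|exists u0].
by apply: ub_le_sup; [exact: has_ubound_avg|exists u].
Qed.

(** * From the pointwise error to the risk *)

(** Convexity of the power function, applied at the midpoint of [a] and [b]. *)
Lemma powR_sum_le {R : realType} (q a b : R) :
  1 <= q -> 0 <= a -> 0 <= b ->
  (a + b) `^ q <= 2 `^ q / 2 * (a `^ q + b `^ q).
Proof.
move=> q1 a0 b0.
have half : (2^-1 * a + 2^-1 * b) `^ q <= 2^-1 * a `^ q + 2^-1 * b `^ q.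
  rewrite {2 4}(_ : 2^-1 = 1 - 2^-1); last by lra.
  by apply: (convex_powR q1 (Itv01 _ _)) => //=;
    rewrite ?inE /= ?in_itv /= ?andbT ?invr_ge0 // invf_le1 ?ler1n.
have -> : a + b = 2 * (2^-1 * a + 2^-1 * b) by lra.
rewrite powRM ?addr_ge0 ?mulr_ge0 ?invr_ge0 //.
by rewrite -mulrA mulrDr; apply: ler_wpM2l => //; exact: powR_ge0.
Qed.

Lemma expectation_pos_part_le {d : measure_display} {T : measurableType d}
    {R : realType} (P : probability T R) (q r : R) (X S : T -> R) :
  1 <= q -> 0 <= r -> measurable_fun setT X -> measurable_fun setT S ->
  (forall w, X w <= r `^ q^-1 + S w) ->
  ('E_P[fun w => (pos_part (S w) `^ q)%R] <= r%:E)%E ->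
  ('E_P[fun w => (pos_part (X w) `^ q)%R] <= (2 `^ q * r)%:E)%E.
Proof.
move=> q1 r0 mX mS XS ES.
have q0 : q != 0 by rewrite gt_eqF // (lt_le_trans ltr01).
have mpos (Z : T -> R) : measurable_fun setT Z ->
    measurable_fun setT (fun w => pos_part (Z w) `^ q).
  move=> mZ; apply: (measurableT_comp (measurable_powR q)).
  exact: measurable_maxr.
have pos_ge0 (t : R) : 0 <= pos_part t by rewrite /pos_part le_max lexx orbT.
pose c : R := 2 `^ q / 2.
have c0 : 0 <= c by rewrite divr_ge0 ?powR_ge0.
(* [powR_sum_le] at [a = r `^ q^-1], for which [a `^ q = r]. *)
have bound w : pos_part (X w) `^ q <= c * (r + pos_part (S w) `^ q).
  have := @powR_sum_le R q (r `^ q^-1) (pos_part (S w)) q1 (powR_ge0 _ _)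
    (pos_ge0 _).
  rewrite -powRrM mulVf // powRr1 // => /(le_trans _); apply.
  apply: ge0_ler_powR; rewrite ?nnegrE ?addr_ge0 ?powR_ge0 //.
    exact: le_trans ler01 q1.
  rewrite /pos_part ge_max; apply/andP; split.
    by apply: le_trans (XS w) _; rewrite lerD2l le_max lexx.
  exact: addr_ge0 (powR_ge0 _ _) (pos_ge0 _).
move: ES; rewrite !unlock => ES.
apply: (@le_trans _ _ (\int[P]_w (c%:E * (r%:E + (pos_part (S w) `^ q)%:E)))%E).
  apply: ge0_le_integral => //.
  - by move=> w _; rewrite lee_fin powR_ge0.
  - by apply/measurable_EFinP; exact: mpos.
  - apply: measurable_funeM; apply: emeasurable_funD => //.
    by apply/measurable_EFinP; exact: mpos.
  - by move=> w _; rewrite -EFinD -EFinM lee_fin.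
rewrite ge0_integralZl_EFin //; first last.
- apply: emeasurable_funD => //.
  by apply/measurable_EFinP; exact: mpos.
- by move=> w _; rewrite -EFinD lee_fin addr_ge0 ?powR_ge0.
rewrite ge0_integralD //; first last.
- by apply/measurable_EFinP; exact: mpos.
- by move=> w _; rewrite lee_fin powR_ge0.
rewrite integral_cst // (_ : (P : {measure set T -> \bar R}) setT = 1%E) ?mule1; last exact: probability_setT.
rewrite (_ : 2 `^ q * r = c * (r + r)); last by rewrite /c; field.
by rewrite [(c * _)%:E]EFinM EFinD lee_wpmul2l ?lee_fin // leeD2l.
Qed.

(** The maximum defining [m_pos] is over a nonempty family because [v = x i] is
    admissible: its block contains [x i]. *)
Lemma m_pos_attained {V : Type} {R : realType} {n : nat} (E : V -> V -> Prop)
    (x : 'I_n -> V) (f : V -> R) (V0 : set V) (q : R) (r : nat -> R)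
    (i : 'I_n) :
  V0 (x i) ->
  exists v, [/\ nobs x (block E (x i) v) = m_pos E x f V0 q r (x i),
    (0 < m_pos E x f V0 q r (x i))%N,
    f v <= f (x i) + r (m_pos E x f V0 q r (x i)) `^ q^-1,
    preceq E (x i) v & V0 v].
Proof.
move=> V0x; have xx := preceq_refl E (x i).
have nobs_lt A : (nobs x A < n.+1)%N.
  by rewrite ltnS -[leqRHS]card_ord max_card.
pose k0 := Ordinal (nobs_lt (block E (x i) (x i))).
rewrite /m_pos (@bigop.bigmax_eq_arg _ k0); last first.
  apply/asboolP; exists (x i); split=> //; first by apply: (@nobs_gt0 _ _ _ _ i).
  by rewrite lerDl powR_ge0.
case: arg_maxnP => [|k /asboolP[v [h1 h2 h3 h4 h5]] _]; last by exists v.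
apply/asboolP; exists (x i); split=> //; first by apply: (@nobs_gt0 _ _ _ _ i).
by rewrite lerDl powR_ge0.
Qed.

Lemma m_pos_le {V : Type} {R : realType} {n : nat} (E : V -> V -> Prop)
    (x : 'I_n -> V) (f : V -> R) (V0 : set V) (q : R) (r : nat -> R) (z : V) :
  (m_pos E x f V0 q r z <= n)%N.
Proof. by apply/bigmax_leqP => k _; rewrite -ltnS. Qed.

(** Stated for plain functions [e] and with the moment bounds given block by
    block, so that it applies to the opposite noise on the reversed graph as well
    as to the original data. *)
Lemma pos_risk_le {V : Type} {R : realType} {n : nat} {d : measure_display}
    {T : measurableType d} (P : probability T R) (E : V -> V -> Prop)
    (x : 'I_n -> V) (e : 'I_n -> T -> R) (q : R) (f : V -> R) (V0 : set V)
    (r : nat -> R) (fhat : V -> T -> R) (i : 'I_n) :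
  (forall j, measurable_fun setT (e j)) -> 1 <= q -> nondecreasing_on E f ->
  is_rate r ->
  (forall z v, (0 < nobs x (block E z v))%N -> preceq E z v -> V0 v ->
    ('E_P[fun w => (pos_part (sup [set avg x (fun j => e j w) (block E u v) |
        u in [set u | preceq E u z]]) `^ q)%R] <=
      (r (nobs x (block E z v)))%:E)%E) ->
  (forall z, measurable_fun setT (fhat z)) ->
  (forall w, is_block_estimate E x (fun j => f (x j) + e j w)
    (fun z => fhat z w)) ->
  V0 (x i) ->
  ('E_P[fun w => (pos_part (fhat (x i) w - f (x i)) `^ q)%R] <=
     (2 `^ q * r (m_pos E x f V0 q r (x i)))%:E)%E.
Proof.
move=> me q1 f_nd [r_ge0 _] noise mfhat hblock V0x.
have [v [m_eq m_gt0 fv xv V0v]] := @m_pos_attained V R n E x f V0 q r i V0x.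
apply: (@expectation_pos_part_le _ _ _ P q _ _ (fun w =>
  sup [set avg x (fun j => e j w) (block E u v) |
        u in [set u | preceq E u (x i)]])) => //.
- exact: r_ge0.
- exact: measurable_funB.
- apply: measurable_sup_avg => //; exists (x i); exact: preceq_refl.
- move=> w; have := block_error_le _ _ _ _ _ _ _ f_nd (hblock w) xv; lra.
- by rewrite -m_eq noise // m_eq.
Qed.

(** * Summation over the design points *)

Lemma pos_part_neg_part_powR {R : realType} (q t : R) : q != 0 ->
  `|t| `^ q = pos_part t `^ q + neg_part t `^ q.
Proof.
move=> q0; rewrite /pos_part /neg_part; have [t0|t0] := leP 0 t.
  by rewrite ger0_norm // max_r ?oppr_le0 // powR0 // addr0.
by rewrite ltr0_norm // max_l ?oppr_ge0 ?(ltW t0) // powR0 // add0r.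
Qed.

(** Let [c m] count the indices with [k i <= m]. The left-hand side is the sum
    on the right with [c] in place of [l], so by summation by parts the gap
    between the two is a combination of the differences [l m - c m >= 0] with
    coefficients [r m - r m.+1 >= 0], plus the boundary term
    [r M * (l M - c M)]. *)
Lemma sum_rate_le {I : finType} {R : realType} (P : pred I) (k : I -> nat)
    (r l : nat -> R) (M : nat) :
  is_rate r ->
  (forall m, (#|[pred i | P i && (k i <= m)%N]|)%:R <= l m) ->
  l 0%N = 0 ->
  (forall i, P i -> (0 < k i)%N) ->
  (forall i, P i -> (k i <= M)%N) ->
  \sum_(i | P i) r (k i) <= \sum_(1 <= m < M.+1) r m * (l m - l m.-1).
Proof.
move=> [r_ge0 r_dec] l_ge l0 k_gt0 k_le.
pose c (m : nat) : R := (#|[pred i | P i && (k i <= m)%N]|)%:R.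
have cE m : c m = \sum_(i | P i && (k i <= m)%N) 1.
  by rewrite /c -sum1_card natr_sum.
have split_le (F : I -> R) m : \sum_(i | P i && (k i <= m.+1)%N) F i =
    \sum_(i | P i && (k i <= m)%N) F i + \sum_(i | P i && (k i == m.+1)) F i.
  rewrite (bigID (fun i => k i <= m)%N) /=; congr (_ + _); apply: eq_bigl => i;
    rewrite -andbA; congr (_ && _).
    by case: (leqP (k i) m) => h; rewrite ?andbT ?andbF // leqW.
  by rewrite -ltnNge -eqn_leq.
(* Keeping the boundary term makes the inequality provable by induction. *)
suff main m : \sum_(i | P i && (k i <= m)%N) r (k i) + r m * (l m - c m) <=
    \sum_(1 <= j < m.+1) r j * (l j - l j.-1).
  have [M0|M_gt0] := posnP M.
    rewrite M0 big_geq // big_pred0 // => i; apply/negP => Pi.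
    by have := leq_trans (k_gt0 i Pi) (k_le i Pi); rewrite M0.
  apply: le_trans (main M).
  rewrite (eq_bigl (fun i => P i && (k i <= M)%N)).
    by rewrite lerDl mulr_ge0 ?r_ge0 ?subr_ge0 ?l_ge.
  by move=> i; case Pi: (P i) => //=; rewrite k_le.
have c0 : c 0%N = 0 by apply/le_anti; rewrite -{1}l0 l_ge ler0n.
elim: m => [|m IH].
  rewrite c0 l0 subrr mulr0 addr0 big_geq // big_pred0 // => i.
  by apply/negP => /andP[/k_gt0 k_i]; rewrite leqNgt k_i.
rewrite big_nat_recr //=; apply: le_trans (lerD IH (lexx _)).
(* At [m = 0] nothing is known of [r 0], but the factor [l 0 - c 0] vanishes. *)
have r_step : r m.+1 * (l m - c m) <= r m * (l m - c m).
  have [m0|m_gt0] := posnP m.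
    by rewrite m0 c0 l0 subrr !mulr0.
  by rewrite ler_wpM2r ?subr_ge0 ?l_ge ?r_dec.
have -> : \sum_(i | P i && (k i <= m.+1)%N) r (k i) =
    \sum_(i | P i && (k i <= m)%N) r (k i) + r m.+1 * (c m.+1 - c m).
  rewrite split_le !cE split_le [X in _ * X]addrC addKr mulr_sumr; congr (_ + _).
  by apply: eq_bigr => i /andP[_ /eqP ->]; rewrite mulr1.
lra.
Qed.

(** Once [M] exceeds all [k i], every partial sum dominates the finite sum, hence
    so does the limit. *)
Lemma sum_rate_le_series {I : finType} {R : realType} (Q : pred I)
    (k : I -> nat) (n : nat) (c : R) (r l : nat -> R) :
  0 <= c -> is_rate r ->
  (forall m, (#|[pred i | Q i && (k i <= m)%N]|)%:R <= l m) ->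
  l 0%N = 0 ->
  (forall i, Q i -> (0 < k i)%N) ->
  (forall i, Q i -> (k i <= n)%N) ->
  cvgn (fun M => \sum_(1 <= m < M) (c * r m * (l m - l m.-1))%:E)%E ->
  ((\sum_(i | Q i) c * r (k i))%:E <=
     \sum_(1 <= m <oo) (c * r m * (l m - l m.-1))%:E)%E.
Proof.
move=> c0 [r_ge0 r_dec] l_ge l0 k_gt0 k_le cvg_l.
apply: lime_ge => //; exists n.+1 => // -[//|M] /= nM.
rewrite sumEFin lee_fin.
apply: (@sum_rate_le _ _ _ _ (fun m => c * r m)) => //.
  split=> [m m0|m m' m0 mm']; first by rewrite mulr_ge0 ?r_ge0.
  by rewrite ler_wpM2l ?r_dec.
by move=> i Qi; exact: leq_trans (k_le i Qi) nM.
Qed.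

Theorem theorem1 (R : realType) (V : Type) (E : V -> V -> Prop)
  (d : measure_display) (T : measurableType d) (P : probability T R)
  (n : nat) (x : 'I_n -> V) (eps : 'I_n -> {RV P >-> R}) (sigma : R)
  (eps_indep : mutually_independent eps)
  (eps_mean : forall i : 'I_n, ('E_P[eps i] = 0)%E)
  (eps_var : forall i : 'I_n, ('V_P[eps i] <= (sigma ^+ 2)%:E)%E)
  (q : R) (q_ge1 : 1 <= q)
  (f : V -> R) (f_nondec : nondecreasing_on E f)
  (V0 : set V)
  (rp rn : nat -> R) (rp_rate : is_rate rp) (rn_rate : is_rate rn)
  (rp_bound : forall m : nat, (0 < m)%N ->
    (max_noise_pos E x eps V0 q m <= (rp m)%:E)%E)
  (rn_bound : forall m : nat, (0 < m)%N ->
    (max_noise_neg E x eps V0 q m <= (rn m)%:E)%E)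
  (fhat : V -> {RV P >-> R})
  (fhat_block : forall w : T,
    is_block_estimate E x (fun i => f (x i) + eps i w) (fun z => fhat z w)) :
  (forall i : 'I_n, x i \in V0 ->
    ('E_P[fun w => (pos_part (fhat (x i) w - f (x i)) `^ q)%R] <=
       (2 `^ q * rp (m_pos E x f V0 q rp (x i)))%:E)%E /\
    ('E_P[fun w => (neg_part (fhat (x i) w - f (x i)) `^ q)%R] <=
       (2 `^ q * rn (m_neg E x f V0 q rn (x i)))%:E)%E)
  /\
  (forall lp ln : nat -> R,
    (forall m : nat, (ell x V0 (m_pos E x f V0 q rp) m)%:R <= lp m) ->
    (forall m : nat, (ell x V0 (m_neg E x f V0 q rn) m)%:R <= ln m) ->
    lp 0%N = 0 -> ln 0%N = 0 ->
    (* both series have a sum, possibly infinite *)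
    cvgn (fun M => \sum_(1 <= m < M)
      (2 `^ q * rp m * (lp m - lp m.-1))%:E)%E ->
    cvgn (fun M => \sum_(1 <= m < M)
      (2 `^ q * rn m * (ln m - ln m.-1))%:E)%E ->
    (\sum_(i < n | x i \in V0) 'E_P[fun w => (`|fhat (x i) w - f (x i)| `^ q)%R] <=
       \sum_(1 <= m <oo) (2 `^ q * rp m * (lp m - lp m.-1))%:E +
       \sum_(1 <= m <oo) (2 `^ q * rn m * (ln m - ln m.-1))%:E)%E).
Proof.
have q0 : q != 0 by rewrite gt_eqF // (lt_le_trans ltr01).
have meas (X : {RV P >-> R}) : measurable_fun setT X by exact: measurable_funPT.
have pos_risk i : x i \in V0 ->
    ('E_P[fun w => (pos_part (fhat (x i) w - f (x i)) `^ q)%R] <=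
       (2 `^ q * rp (m_pos E x f V0 q rp (x i)))%:E)%E.
  move=> /set_mem V0x.
  apply: (@pos_risk_le _ _ _ _ _ P E x (fun j => eps j : T -> R) q f V0 rp
    (fun z => fhat z : T -> R) i) => //.
  move=> z v m_gt0 zv V0v; apply: le_trans (rp_bound _ m_gt0).
  rewrite /max_noise_pos le_max; apply/orP; right.
  by apply: ereal_sup_ubound; exists z, v.
(* Reversed graph, with [- f], [- eps] and [- fhat] as data. *)
have neg_risk i : x i \in V0 ->
    ('E_P[fun w => (neg_part (fhat (x i) w - f (x i)) `^ q)%R] <=
       (2 `^ q * rn (m_neg E x f V0 q rn (x i)))%:E)%E.
  move=> /set_mem V0x; rewrite m_neg_rev.
  have := @pos_risk_le _ _ _ _ _ P (rev_edge E) x (fun j w => - eps j w) q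
    (fun v => - f v) V0 rn (fun z w => - fhat z w) i.
  rewrite (_ : (fun w => _) =
      fun w => neg_part (fhat (x i) w - f (x i)) `^ q); last first.
    by apply/funext => w; rewrite /pos_part /neg_part opprB opprK addrC.
  apply=> //.
  - by move=> j; apply: measurableT_comp.
  - by move=> a b; rewrite (preceq_rev E) lerN2; exact: f_nondec.
  - move=> z v; rewrite (block_rev E) (preceq_rev E) => m_gt0 vz V0v.
    apply: le_trans (rn_bound _ m_gt0).
    rewrite /max_noise_neg le_max; apply/orP; right.
    apply: ereal_sup_ubound; exists z, v; split=> //; congr expectation.
    apply/funext => w; rewrite /neg_part -sup_opp /pos_part.
    congr (Num.max (sup _) 0 `^ q).
    rewrite (_ : [set u | preceq (rev_edge E) u z] = [set u | preceq E z u]).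
      by apply: eq_imagel => u _; rewrite (block_rev E) avgN.
    by apply/seteqP; split=> u; rewrite /= (preceq_rev E).
  - by move=> z; apply: measurableT_comp.
  - move=> w; have := is_block_estimate_rev _ _ _ _ (fhat_block w).
    by congr is_block_estimate; apply/funext => j; rewrite opprD.
split; first by move=> i V0x; split; [exact: pos_risk|exact: neg_risk].
move=> lp ln lp_ge ln_ge lp0 ln0 cvg_p cvg_n.
have E_split i : ('E_P[fun w => (`|fhat (x i) w - f (x i)| `^ q)%R] =
    'E_P[fun w => (pos_part (fhat (x i) w - f (x i)) `^ q)%R] +
     'E_P[fun w => (neg_part (fhat (x i) w - f (x i)) `^ q)%R])%E.
  have mdiff : measurable_fun setT (fun w => fhat (x i) w - f (x i)).
    exact: measurable_funB.
  rewrite !unlock -ge0_integralD //.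
  - apply: eq_integral => w _.
    by rewrite pos_part_neg_part_powR.
  - by move=> w _; rewrite lee_fin powR_ge0.
  - apply/measurable_EFinP; apply: (measurableT_comp (measurable_powR q)).
    exact: measurable_maxr.
  - by move=> w _; rewrite lee_fin powR_ge0.
  - apply/measurable_EFinP; apply: (measurableT_comp (measurable_powR q)).
    by apply: measurable_maxr => //; exact: measurableT_comp.
under eq_bigr do rewrite E_split.
rewrite big_split /=; apply: leeD.
  apply: le_trans (sum_rate_le_series _
    (fun i => m_pos E x f V0 q rp (x i)) n _ _ _ (powR_ge0 2 q) rp_rate
    lp_ge lp0 _ _ cvg_p).
  - by rewrite -sumEFin; apply: lee_sum => i; exact: pos_risk.
  - move=> i /set_mem V0x.
    by have [v []] := @m_pos_attained V R n E x f V0 q rp i V0x.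
  - by move=> i _; exact: m_pos_le.
apply: le_trans (sum_rate_le_series _
  (fun i => m_neg E x f V0 q rn (x i)) n _ _ _ (powR_ge0 2 q) rn_rate
  ln_ge ln0 _ _ cvg_n).
- by rewrite -sumEFin; apply: lee_sum => i; exact: neg_risk.
- move=> i /set_mem V0x; rewrite m_neg_rev.
  by have [v []] := @m_pos_attained V R n (rev_edge E) x (fun v => - f v) V0 q rn i V0x.
- by move=> i _; rewrite m_neg_rev; exact: m_pos_le.
Qed.
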